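(* Let $T>0$, $I=[0,T]$, and let $\kappa\in\mathscr{K}_{\mathrm{reg}}$ be a regular admissible kernel. Then: (1) For every $t\in I$, $\int_0^t\kappa(t-s)\,ds\le 1$. In particular, the normalization condition $\int_0^T\kappa(\tau)\,d\tau=1$ is satisfied. (2) For every $f\in\mathcal{C}(I)$ and every $t\in I$, $\int_0^t\kappa(t-s)|f(s)|\,ds\le\|f\|_\infty$. (3) For every $f,g\in\mathcal{C}(I)$ and every $t\in I$, $$\left|\int_0^t\kappa(t-s)\bigl(f(s)-g(s)\bigr)\,ds\right|\le\|f-g\|_\infty.$$
   Context: $\mathcal{C}(I)$ is the set of continuous functions $I\to\mathbb{R}$ and $\|f\|_\infty:=\sup_{s\in I}|f(s)|$. Regular admissible kernels: $\mathscr{K}_{\mathrm{reg}}$ is the set of Lebesgue measurable, integrable functions $\kappa:I\to[0,\infty)$ such that (uniform boundedness) there are constants $0<m_\kappa\le M_\kappa<\infty$ with $m_\kappa\le\kappa(\tau)\le M_\kappa$ for all $\tau\in I$; (normalization) $\int_0^T\kappa(\tau)\,d\tau=1$; (Lipschitz continuity) there is $L_\kappa>0$ with $|\kappa(\tau_1)-\kappa(\tau_2)|\le L_\kappa|\tau_1-\tau_2|$ for all $\tau_1,\tau_2\in I$. *)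

(* Defs.v *)
From mathcomp Require Import all_boot all_order all_algebra.
From mathcomp Require Import all_classical all_reals all_analysis.
Set Implicit Arguments.
Unset Strict Implicit.
Unset Printing Implicit Defensive.
Import Order.TTheory GRing.Theory Num.Theory.
Import numFieldNormedType.Exports.
Local Open Scope classical_set_scope.
Local Open Scope ring_scope.

(* The completed measure is used because [lebesgue_measure] lives on the Borel
   sigma-algebra, while kernels are only assumed Lebesgue measurable. *)
Notation leb := completed_lebesgue_measure.

(* Functions on I = [0, T] are represented by functions on R whose values
   outside [0, T] are unconstrained. Measurability on [0, T] is part of
   [integrable]. *)
Record regular_kernel (R : realType) (T : R) (kappa : R -> R) : Prop :=
  RegularKernel {
    kernel_integrable : leb.-integrable `[0, T] (EFin \o kappa);
    kernel_ge0 : forall tau : R, tau \in `[0, T] -> 0 <= kappa tau;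
    kernel_bounded : exists m M : R,
      [/\ 0 < m, m <= M &
          forall tau : R, tau \in `[0, T] -> m <= kappa tau <= M];
    kernel_normalized : (\int[leb]_(tau in `[0%R, T]) (kappa tau)%:E = 1)%E;
    kernel_lipschitz : exists2 L : R, 0 < L &
      forall tau1 tau2 : R, tau1 \in `[0, T] -> tau2 \in `[0, T] ->
        `|kappa tau1 - kappa tau2| <= L * `|tau1 - tau2|
  }.

(* For f continuous on [0, T] and 0 <= T the set is nonempty and bounded above,
   so [sup] does not take its default value. *)
Definition uniform_norm (R : realType) (T : R) (f : R -> R) : R :=
  sup [set `|f s| | s in `[0, T]].

(* Main.v *)
Require Import Defs.
From mathcomp Require Import all_boot all_order all_algebra.
From mathcomp Require Import all_classical all_reals all_analysis.
From mathcomp Require Import measurable_realfun.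
Import Order.TTheory GRing.Theory Num.Theory.
Import numFieldNormedType.Exports.
Local Open Scope classical_set_scope.
Local Open Scope ring_scope.

(** The substitution s -> t - s turns the integral of kappa (t - s) over [0, t]
    into that of kappa over [0, t]; since kappa is nonnegative, this is at most
    its integral over [0, T], which is 1 ([integral_kernel_reflect_le1]).
    Integrating a continuous h against kappa (t - s) therefore averages, with
    total weight at most 1, values bounded by the uniform norm of h, whence the
    other two bounds ([integral_kernel_norm_le], [abse_integral_kernel_le]).

    The delicate point is the measure: the change of variables is a theorem
    about Lebesgue measure on Borel sets, whereas the integrals are taken for
    its completion. The Lipschitz condition makes kappa continuous, so that
    every integrand is Borel measurable on the interval of integration, and
    [ge0_integral_completed] identifies the two integrals of a nonnegative such
    function: Lebesgue measure is the image of its completion under the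
    identity map. *)

(** The identity map, seen as going from the Caratheodory sigma-algebra to the
    smaller Borel one; it carries the completion to Lebesgue measure. *)
Lemma measurable_id_completed {R : realType} :
  measurable_fun [set: caratheodory_type (wlength (@idfun R))^*%mu]
    (fun x => x : measurableTypeR R).
Proof.
move=> _ A mA; rewrite setTI preimage_id.
exact: sub_caratheodory.
Qed.

Lemma measurable_completed {R : realType} (D : set R) :
  measurable D ->
  measurable (D : set (caratheodory_type (wlength (@idfun R))^*%mu)).
Proof. exact: sub_caratheodory. Qed.

Lemma measurable_fun_completed {R : realType} d (Y : measurableType d)
    (D : set R) (f : R -> Y) :
  measurable D -> measurable_fun D f ->
  measurable_fun (D : set (caratheodory_type (wlength (@idfun R))^*%mu)) f.
Proof.
by move=> mD mf _ B mB; apply: measurable_completed; exact: mf.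
Qed.

(** The completion agrees with Lebesgue measure on Borel sets, so this is
    integration against an image measure, for the identity map. *)
Lemma ge0_integral_completed {R : realType} (D : set R) (f : R -> \bar R) :
  measurable D -> measurable_fun D f -> (forall x, D x -> 0 <= f x)%E ->
  (\int[leb]_(x in D) f x = \int[lebesgue_measure]_(x in D) f x)%E.
Proof.
move=> mD mf f0.
have := @ge0_integral_pushforward _ _ _ (measurableTypeR R) R _
  measurable_id_completed leb D f mD mf.
move=> <-; last by move=> x /[!inE]; exact: f0.
by apply: eq_measure_integral => [|? A mA _]; first exact: measurable_id_completed.
Qed.

Lemma integral_reflect {R : realType} (t : R) (h : R -> R) : 0 <= t ->
  {within `[0, t], continuous h} ->
  (\int[lebesgue_measure]_(s in `[0%R, t]) (h (t - s))%:E =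
   \int[lebesgue_measure]_(s in `[0%R, t]) (h s)%:E)%E.
Proof.
move=> t0 ch.
have dF (x : R) : is_derive x (1 : R) (fun s : R => t - s) (-1 : R).
  have -> : (fun s : R => t - s) = (cst t : R -> R) - (id : R -> R) by [].
  by rewrite -[-1]add0r; apply: is_deriveB.
have dE : derive1 (fun s : R => t - s) = cst (-1 : R).
  by apply/funext => x; rewrite derive1E; apply: derive_val.
have cF (x : R) : {for x, continuous (fun s : R => t - s)}.
  by apply: differentiable_continuous; apply/derivable1_diffP; have [] := dF x.
have := @integration_by_substitution_decreasing R (fun s : R => t - s) h 0 t t0.
rewrite subr0 subrr => -> //.
- by apply: eq_integral => x _; rewrite !fctE dE /= opprK mulr1.
- by move=> x y _ _ xy; rewrite ltrD2l ltrN2.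
- by rewrite dE => ? _; exact: cvg_cst.
- by rewrite dE; exact: is_cvg_cst.
- by rewrite dE; exact: is_cvg_cst.
- split.
  + by move=> x _; have [] := dF x.
  + by apply: cvg_at_right_filter; exact: cF.
  + by apply: cvg_at_left_filter; exact: cF.
Qed.

(** The supremum is a bound only because the values are bounded above, which the
    extreme value theorem provides. *)
Lemma le_uniform_norm {R : realType} {T : R} {f : R -> R} {s : R} :
  {within `[0, T], continuous f} -> s \in `[0, T] ->
  `|f s| <= uniform_norm T f.
Proof.
move=> cf sT.
have T0 : 0 <= T by move: sT; rewrite in_itv/= => /andP[]; exact: le_trans.
have cnf : {within `[0, T], continuous (fun x => `|f x|)}.
  move=> x; apply: (@continuous_comp (subspace `[0, T]) _ _ f); first exact: cf.
  exact: norm_continuous.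
have [c cT fc] := EVT_max T0 cnf.
apply: ub_le_sup; last by exists s.
by exists `|f c| => _ [x xT <-]; exact: fc.
Qed.

Lemma lipschitz_within_continuous {R : realType} (A : set R) (f : R -> R)
    (L : R) :
  0 < L -> (forall x y, A x -> A y -> `|f x - f y| <= L * `|x - y|) ->
  {within A, continuous f}.
Proof.
move=> L0 fL; apply/subspace_continuousP => x Ax.
apply/cvgrPdist_le => /= e e0.
rewrite !near_withinE; near=> y => Ay.
apply: (le_trans (fL _ _ Ax Ay)); rewrite -ler_pdivlMl// mulrC.
near: y; apply: (cvgr_dist_le id); [exact: cvg_id|exact: divr_gt0].
Unshelve. all: by end_near. Qed.

Lemma kernel_continuous {R : realType} {T : R} {kappa : R -> R} :
  regular_kernel T kappa -> {within `[0, T], continuous kappa}.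
Proof.
move=> -[_ _ _ _ [L L0 kL]].
by apply: (@lipschitz_within_continuous _ _ _ L) => // x y xT yT; exact: kL.
Qed.

Lemma measurable_fun_within_continuous {R : realType} {a b : R} {f : R -> R} :
  {within `[a, b], continuous f} -> measurable_fun `[a, b] f.
Proof. by move=> cf; apply: subspace_continuous_measurable_fun. Qed.

Lemma reflect_itv {R : realType} (t s : R) :
  (t - s \in `[0, t]) = (s \in `[0, t]).
Proof. by rewrite !in_itv/= subr_ge0 lerBlDr lerDl andbC. Qed.

Lemma measurable_fun_reflect {R : realType} (t : R) (h : R -> R) :
  measurable_fun `[0, t] h -> measurable_fun `[0, t] (fun s => h (t - s)).
Proof.
move=> mh; apply: (measurable_comp (F := `[0, t])) => //.
- by move=> _ [s st <-]; rewrite /= reflect_itv.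
- exact: measurable_funB.
Qed.

Section convolution.
Context {R : realType} {T : R} {kappa : R -> R}.
Hypothesis kappa_reg : regular_kernel T kappa.
Context {t : R}.
Hypothesis tT : t \in `[0, T].

Let t0 : 0 <= t. Proof. by move: tT; rewrite in_itv/= => /andP[]. Qed.

Let sub_tT : `[0, t] `<=` `[0, T].
Proof.
by apply: subset_itvl; rewrite bnd_simp; move: tT; rewrite in_itv/= => /andP[].
Qed.

Let ck : {within `[0, t], continuous kappa}.
Proof. exact: (continuous_subspaceW sub_tT (kernel_continuous kappa_reg)). Qed.

Let mk_reflect : measurable_fun `[0, t] (fun s => kappa (t - s)).
Proof.
by apply: measurable_fun_reflect; exact: measurable_fun_within_continuous ck.
Qed.

Let k_reflect_ge0 s : s \in `[0, t] -> 0 <= kappa (t - s).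
Proof.
rewrite -reflect_itv => st; apply: (kernel_ge0 kappa_reg).
exact: sub_tT st.
Qed.

Lemma integral_kernel_reflect_le1 :
  (\int[leb]_(s in `[0%R, t]) (kappa (t - s))%:E <= 1)%E.
Proof.
have mkT := measurable_fun_within_continuous (kernel_continuous kappa_reg).
rewrite -(kernel_normalized kappa_reg) !ge0_integral_completed//.
- rewrite integral_reflect//; apply: ge0_subset_integral => //.
  + exact/measurable_EFinP.
  + by move=> x xT; rewrite lee_fin; exact: (kernel_ge0 kappa_reg).
- exact/measurable_EFinP.
- by move=> x xT; rewrite lee_fin; exact: (kernel_ge0 kappa_reg).
- exact/measurable_EFinP.
Qed.

(** The bound C comes out of the integral, and the remaining weight is at most
    1. *)
Lemma integral_kernel_norm_le {h : R -> R} {C : R} :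
  measurable_fun `[0, t] h -> 0 <= C ->
  (forall s, s \in `[0, t] -> `|h s| <= C) ->
  (\int[leb]_(s in `[0%R, t]) (kappa (t - s) * `|h s|)%:E <= C%:E)%E.
Proof.
move=> mh C0 hC.
have mkC : measurable_fun
    (`[0, t] : set (caratheodory_type (wlength (@idfun R))^*%mu))
    (fun s => (kappa (t - s))%:E).
  by apply: measurable_fun_completed => //; exact/measurable_EFinP.
apply: (@le_trans _ _
    (\int[leb]_(s in `[0%R, t]) (C%:E * (kappa (t - s))%:E))%E).
  apply: ge0_le_integral => //.
  - exact: measurable_completed.
  - by move=> s st; rewrite lee_fin mulr_ge0// k_reflect_ge0.
  - apply: measurable_fun_completed => //; apply/measurable_EFinP.
    by apply: measurable_funM => //; exact: measurableT_comp.
  - by apply: measurable_funeM.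
  - move=> s st; rewrite -EFinM lee_fin mulrC.
    by rewrite ler_wpM2r ?hC// k_reflect_ge0.
rewrite ge0_integralZl//.
- by rewrite -[leRHS]mule1 lee_wpmul2l ?lee_fin// integral_kernel_reflect_le1.
- exact: measurable_completed.
Qed.

Lemma abse_integral_kernel_le {h : R -> R} {C : R} :
  measurable_fun `[0, t] h -> 0 <= C ->
  (forall s, s \in `[0, t] -> `|h s| <= C) ->
  (`| \int[leb]_(s in `[0%R, t]) (kappa (t - s) * h s)%:E | <= C%:E)%E.
Proof.
move=> mh C0 hC; apply: le_trans (integral_kernel_norm_le mh C0 hC).
rewrite (_ : (\int[leb]_(s in _) (kappa (t - s) * `|h s|)%:E =
    \int[leb]_(s in `[0%R, t]) `|(kappa (t - s) * h s)%:E|)%E); last first.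
  apply: eq_integral => s; rewrite inE => st.
  by rewrite /= normrM ger0_norm// k_reflect_ge0.
apply: le_abse_integral; first exact: measurable_completed.
apply: measurable_fun_completed => //; apply/measurable_EFinP.
exact: measurable_funM.
Qed.

End convolution.

Theorem lemma2p1 (R : realType) (T : R) (kappa : R -> R) (T_gt0 : 0 < T)
    (kappa_reg : regular_kernel T kappa) :
  [/\ (forall t : R, t \in `[0, T] ->
         (\int[leb]_(s in `[0%R, t]) (kappa (t - s)%R)%:E <= 1)%E)
        /\ (\int[leb]_(tau in `[0%R, T]) (kappa tau)%:E = 1)%E,
      (forall f : R -> R, {within `[0, T], continuous f} ->
       forall t : R, t \in `[0, T] ->
         (\int[leb]_(s in `[0%R, t]) (kappa (t - s) * `|f s|)%R%:E
            <= (uniform_norm T f)%:E)%E)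
    & (forall f g : R -> R,
         {within `[0, T], continuous f} -> {within `[0, T], continuous g} ->
       forall t : R, t \in `[0, T] ->
         (`| \int[leb]_(s in `[0%R, t]) (kappa (t - s) * (f s - g s))%R%:E |
            <= (uniform_norm T (fun s => (f s - g s)%R))%:E)%E)].
Proof.
have zero_in : 0 \in `[0, T] by rewrite in_itv/= lexx ltW.
have bound (h : R -> R) (t : R) : {within `[0, T], continuous h} ->
    t \in `[0, T] ->
    [/\ measurable_fun `[0, t] h, 0 <= uniform_norm T h &
        forall s, s \in `[0, t] -> `|h s| <= uniform_norm T h].
  move=> ch tT.
  have sub_tT : `[0, t] `<=` `[0, T].
    apply: subset_itvl; rewrite bnd_simp.
    by move: tT; rewrite in_itv/= => /andP[].
  split.
  - apply: measurable_fun_within_continuous.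
    exact: (continuous_subspaceW sub_tT ch).
  - exact: le_trans (le_uniform_norm ch zero_in).
  - by move=> s st; apply: (le_uniform_norm ch); exact: sub_tT st.
split.
- split; last exact: kernel_normalized.
  by move=> t; exact: integral_kernel_reflect_le1.
- move=> f cf t tT; have [mf f0 fC] := bound f t cf tT.
  exact: (integral_kernel_norm_le kappa_reg).
- move=> f g cf cg t tT.
  have cfg : {within `[0, T], continuous (fun s => f s - g s)}.
    move=> x; apply: (@continuousB _ _ (subspace `[0, T])); first exact: cf.
    exact: cg.
  have [mh h0 hC] := bound _ t cfg tT.
  exact: (abse_integral_kernel_le kappa_reg).
Qed.
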